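(* Let $k\geq 1$ be an integer, and let $\mathcal{A}_k$ be a multiple saddle-point matrix with blocks $A_0,\dots,A_k$, $B_1,\dots,B_k$ as described in the context, where $A_0$ is symmetric positive definite, $A_1,\dots,A_k$ are symmetric positive semi-definite, and $\ker(A_j)\cap\ker(B_j^T)=\{0\}$ for $j=1,\dots,k$. Let $\mathcal{P}_k=\mathcal{P}_{L,k}\mathcal{P}_{D,k}^{-1}\mathcal{P}_{U,k}$ be the preconditioner defined in the context. Then the preconditioned matrix $\mathcal{P}_k^{-1}\mathcal{A}_k$ has two distinct eigenvalues. Specifically, it has $\sum_{j=0}^{\lfloor k/2\rfloor} n_{2j}$ eigenvalues equal to $1$, and $\sum_{j=1}^{\lfloor (k+1)/2\rfloor} n_{2j-1}$ eigenvalues equal to $-1$ (eigenvalues counted with algebraic multiplicity).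
   Context: All matrices are real. Let $n_0,\dots,n_k$ be positive integers, $A_j\in\mathbb{R}^{n_j\times n_j}$ for $j=0,\dots,k$, and $B_j\in\mathbb{R}^{n_j\times n_{j-1}}$ for $j=1,\dots,k$. The matrix $\mathcal{A}_k$ is the symmetric block tridiagonal matrix of dimension $\sum_{j=0}^k n_j$, with block rows and columns indexed by $0,\dots,k$, whose $(j,j)$ block is $(-1)^jA_j$ for $j=0,\dots,k$, whose $(j,j-1)$ block is $B_j$ and whose $(j-1,j)$ block is $B_j^T$ for $j=1,\dots,k$, and whose other blocks are zero. Define the Schur complements $S_0=A_0$ and $S_j=A_j+B_jS_{j-1}^{-1}B_j^T$ for $j=1,\dots,k$; under the assumptions in the claim these are all symmetric positive definite. Define $\mathcal{P}_{D,k}$ as the block diagonal matrix with diagonal blocks $S_0,S_1,\dots,S_k$. Define $\mathcal{P}_{L,k}$ as the block lower bidiagonal matrix whose $(j,j)$ block is $(-1)^jS_j$ for $j=0,\dots,k$, whose $(j,j-1)$ block is $B_j$ for $j=1,\dots,k$, and whose other blocks are zero. Define $\mathcal{P}_{U,k}=\mathcal{P}_{L,k}^T$. *)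

(* Defs.v *)
From HB Require Import structures.
From mathcomp Require Import all_boot all_order all_algebra.
From mathcomp Require Import reals complex.

Set Implicit Arguments.
Unset Strict Implicit.
Unset Printing Implicit Defensive.

Import GRing.Theory Num.Theory.

Local Open Scope ring_scope.

Definition spd (R : realType) (m : nat) (M : 'M[R]_m) : Prop :=
  M \is symmetricmx /\
  forall x : 'cV[R]_m, x != 0 -> 0 < (x^T *m M *m x) 0 0.

Definition spsd (R : realType) (m : nat) (M : 'M[R]_m) : Prop :=
  M \is symmetricmx /\
  forall x : 'cV[R]_m, 0 <= (x^T *m M *m x) 0 0.

Definition ker_trivial_meet (R : realType) (m1 m2 p : nat)
    (M : 'M[R]_(m1, p)) (N : 'M[R]_(m2, p)) : Prop :=
  forall x : 'cV[R]_p, M *m x = 0 -> N *m x = 0 -> x = 0.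

(* The blocks are given as sequences n, A, B of which only the indices up to k
   are used. B j is the block in position (j, j - 1); as 0.-1 = 0, B 0 is an
   unused square matrix. In the block matrices below, [conform_mx 0 M] is a cast
   of M to the dimensions of its position: the tests on the indices ensure that
   the dimensions always agree, so the default 0 is never returned. *)

Definition saddle_block (R : realType) (n : nat -> nat)
    (A : forall j, 'M[R]_(n j)) (B : forall j, 'M[R]_(n j, n j.-1))
    (i j : nat) : 'M[R]_(n i, n j) :=
  if i == j then conform_mx 0 ((-1) ^+ j *: A j)
  else if i == j.+1 then conform_mx 0 (B i)
  else if j == i.+1 then conform_mx 0 (B j)^T
  else 0.

Definition saddle (R : realType) (n : nat -> nat)
    (A : forall j, 'M[R]_(n j)) (B : forall j, 'M[R]_(n j, n j.-1))
    (k : nat) : 'M[R]_(\sum_(i < k.+1) n i) :=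
  \mxblock_(i < k.+1, j < k.+1) saddle_block A B i j.

Fixpoint schur (R : realType) (n : nat -> nat)
    (A : forall j, 'M[R]_(n j)) (B : forall j, 'M[R]_(n j, n j.-1))
    (j : nat) : 'M[R]_(n j) :=
  match j with
  | 0 => A 0
  | i.+1 => A i.+1 + B i.+1 *m invmx (schur A B i) *m (B i.+1)^T
  end.

Definition precD (R : realType) (n : nat -> nat)
    (A : forall j, 'M[R]_(n j)) (B : forall j, 'M[R]_(n j, n j.-1))
    (k : nat) : 'M[R]_(\sum_(i < k.+1) n i) :=
  \mxdiag_(i < k.+1) schur A B i.

Definition precL_block (R : realType) (n : nat -> nat)
    (A : forall j, 'M[R]_(n j)) (B : forall j, 'M[R]_(n j, n j.-1))
    (i j : nat) : 'M[R]_(n i, n j) :=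
  if i == j then conform_mx 0 ((-1) ^+ j *: schur A B j)
  else if i == j.+1 then conform_mx 0 (B i)
  else 0.

Definition precL (R : realType) (n : nat -> nat)
    (A : forall j, 'M[R]_(n j)) (B : forall j, 'M[R]_(n j, n j.-1))
    (k : nat) : 'M[R]_(\sum_(i < k.+1) n i) :=
  \mxblock_(i < k.+1, j < k.+1) precL_block A B i j.

Definition precU (R : realType) (n : nat -> nat)
    (A : forall j, 'M[R]_(n j)) (B : forall j, 'M[R]_(n j, n j.-1))
    (k : nat) : 'M[R]_(\sum_(i < k.+1) n i) :=
  (precL A B k)^T.

Definition prec (R : realType) (n : nat -> nat)
    (A : forall j, 'M[R]_(n j)) (B : forall j, 'M[R]_(n j, n j.-1))
    (k : nat) : 'M[R]_(\sum_(i < k.+1) n i) :=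
  precL A B k *m invmx (precD A B k) *m precU A B k.

Definition complexify (R : realType) (m : nat) (M : 'M[R]_m) : 'M[R[i]]_m :=
  map_mx (real_complex R) M.

Definition alg_mult (F : fieldType) (m : nat) (z : F) (M : 'M[F]_m) : nat :=
  mup z (char_poly M).

(* Main.v *)
Require Import Defs.
From HB Require Import structures.
From mathcomp Require Import all_boot all_order all_algebra.
From mathcomp Require Import reals complex.
From mathcomp Require Import ring lra zify.

Set Implicit Arguments.
Unset Strict Implicit.
Unset Printing Implicit Defensive.

Import Order.TTheory GRing.Theory Num.Theory.

Local Open Scope ring_scope.

(** The matrix saddle A B k has a block LDU factorization with the same outer
    factors as the preconditioner. Write L = precL, U = L^T, D = precD and let J
    be the diagonal matrix equal to (-1)^i on block i. Then
      saddle A B k = L D^-1 J U: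
    the diagonal block 0 of the product is S_0 = A_0, and for j > 0 block j is
      (-1)^j S_j - (-1)^j B_j S_(j-1)^-1 B_j^T,
    and the recursion defining S_j says precisely that this is (-1)^j A_j; the
    sub- and superdiagonal blocks are B_j and its transpose because each S_j
    cancels its inverse (saddle_LDU). As prec A B k = L D^-1 U, the
    preconditioned matrix is U^-1 J U, similar to J (prec_saddle_similar), so
    its characteristic polynomial is the product of the ('X - (-1)^i)^(n i). The
    eigenvalues and their multiplicities are read off from it, the even block
    indices giving 1 and the odd ones -1.

    All inverses exist because every S_j is symmetric positive definite
    (spd_schur): the form of S_j is the sum of the nonnegative forms of A_j and
    of B_j S_(j-1)^-1 B_j^T, and a vector on which both vanish lies in the
    kernels of A_j and of B_j^T, hence is zero. *)

(** * Definite and semi-definite forms *)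

Lemma symmetricmxP (R : realType) m (M : 'M[R]_m) :
  reflect (M^T = M) (M \is symmetricmx).
Proof.
apply: (iffP (is_hermitianmxP _ _ _)); rewrite expr0 scale1r map_mx_id //.
Qed.

Lemma colnorm2_ge0 (R : realType) m (y : 'cV[R]_m) : 0 <= (y^T *m y) 0 0.
Proof. by rewrite mxE sumr_ge0 // => i _; rewrite mxE -expr2 sqr_ge0. Qed.

Lemma colnorm2_eq0 (R : realType) m (y : 'cV[R]_m) :
  (y^T *m y) 0 0 = 0 -> y = 0.
Proof.
rewrite mxE => /psumr_eq0P y0; apply/colP => i; rewrite mxE.
have /y0/(_ i isT) : forall j : 'I_m, true -> 0 <= y^T 0 j * y j 0.
  by move=> j _; rewrite mxE -expr2 sqr_ge0.
by rewrite mxE -expr2 => /eqP; rewrite sqrf_eq0 => /eqP.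
Qed.

(** An isotropic vector of a semi-definite form is in its kernel: with y = M x,
    the form at x + t y is 2 t |y|^2 + t^2 (y^T M y), which would be negative
    for small t < 0 if y were nonzero. *)
Lemma spsd_form_eq0 (R : realType) m (M : 'M[R]_m) (x : 'cV_m) :
  spsd M -> (x^T *m M *m x) 0 0 = 0 -> M *m x = 0.
Proof.
move=> [/symmetricmxP Msym Mge0] xMx; set y := M *m x.
apply: colnorm2_eq0; set q := _ 0 0.
have q_ge0 : 0 <= q := colnorm2_ge0 y.
pose c := (y^T *m M *m y) 0 0; have c_ge0 : 0 <= c := Mge0 y.
have form t : 0 <= 2 * t * q + t ^+ 2 * c.
  have := Mge0 (x + t *: y).
  have -> : (x + t *: y)^T *m M *m (x + t *: y) =
      x^T *m M *m x + (2 * t) *: (y^T *m y) + t ^+ 2 *: (y^T *m M *m y).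
    have xM : x^T *m M = y^T by rewrite trmx_mul Msym.
    rewrite [(_ + _)^T]linearD linearZ /= !mulmxDl -!scalemxAl xM.
    rewrite !mulmxDr -!scalemxAr scalerDr scalerA -expr2 -(mulmxA _ M x).
    by rewrite -/y mulr_natl mulr2n scalerDl !addrA.
  by rewrite mxE [X in X + _]mxE xMx add0r [X in X + _]mxE [X in _ + X]mxE.
have c1 : 0 < c + 1 by lra.
(* The minimum is at t = - q / c; the denominator c + 1 covers c = 0. *)
have := form (- q / (c + 1)).
have -> : 2 * (- q / (c + 1)) * q + (- q / (c + 1)) ^+ 2 * c =
   - (q ^+ 2 * (c + 2) / (c + 1) ^+ 2) by field; rewrite gt_eqF.
rewrite oppr_ge0 pmulr_lle0 ?invr_gt0 ?exprn_gt0 // pmulr_lle0; last by lra.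
by move=> q2; apply/eqP; rewrite -sqrf_eq0 eq_le q2 sqr_ge0.
Qed.

Lemma unitmx_inj (F : fieldType) m (M : 'M[F]_m) :
  (forall x : 'cV_m, M *m x = 0 -> x = 0) -> M \in unitmx.
Proof.
move=> Minj; rewrite -unitmx_tr -row_free_unit; apply: inj_row_free => v vM.
apply: trmx_inj; rewrite trmx0; apply: Minj.
by rewrite -[M]trmxK -trmx_mul vM trmx0.
Qed.

Lemma spd_unitmx (R : realType) m (M : 'M[R]_m) : spd M -> M \in unitmx.
Proof.
move=> [_ Mgt0]; apply: unitmx_inj => x Mx0.
apply/eqP/negPn/negP => /Mgt0.
by rewrite -mulmxA Mx0 mulmx0 mxE ltxx.
Qed.

Lemma spd_invmx (R : realType) m (M : 'M[R]_m) : spd M -> spd (invmx M).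
Proof.
move=> Mspd; have Mu := spd_unitmx Mspd.
case: Mspd => /symmetricmxP Msym Mgt0; split.
  by apply/symmetricmxP; rewrite trmx_inv Msym.
move=> x x0.
have -> : x^T *m invmx M *m x =
    (invmx M *m x)^T *m M *m (invmx M *m x).
  by rewrite trmx_mul trmx_inv Msym -!mulmxA mulKVmx.
apply: Mgt0; apply: contra_neq x0 => Vx0.
by rewrite -(mulKVmx Mu x) Vx0 mulmx0.
Qed.

(** The two summands have nonnegative forms, and V is definite, so the form of
    the sum vanishes at x only if A x = 0 and B^T x = 0. *)
Lemma spd_schur_step (R : realType) m p (V : 'M[R]_p) (A : 'M[R]_m)
    (B : 'M[R]_(m, p)) :
  spd V -> spsd A -> ker_trivial_meet A B^T -> spd (A + B *m V *m B^T).
Proof.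
move=> [/symmetricmxP Vsym Vgt0] Apsd ker0; split.
  case: Apsd => /symmetricmxP Asym _; apply/symmetricmxP.
  by rewrite linearD /= Asym !trmx_mul trmxK Vsym mulmxA.
move=> x x0; have Age0 := Apsd.2 x.
have -> : x^T *m (A + B *m V *m B^T) *m x =
    x^T *m A *m x + (B^T *m x)^T *m V *m (B^T *m x).
  by rewrite mulmxDr mulmxDl trmx_mul trmxK !mulmxA.
rewrite mxE; have [Bx0|/Vgt0 ?] := eqVneq (B^T *m x) 0; last exact: ltr_wpDl.
rewrite Bx0 mulmx0 [X in _ + X]mxE addr0 lt_neqAle Age0 andbT eq_sym.
by apply: contra_neq x0 => /(spsd_form_eq0 Apsd) Ax0; apply: ker0.
Qed.

(** * Block matrices *)

(** Forward substitution: the block rows of B x = 0 give x_0 = 0, x_1 = 0 and so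
    on, since the diagonal block can be cancelled once all earlier components
    of x are zero. *)
Lemma unitmx_mxblock_lower (F : fieldType) p (p_ : 'I_p -> nat)
    (B_ : forall i j, 'M[F]_(p_ i, p_ j)) :
  (forall i j : 'I_p, (i < j)%N -> B_ i j = 0) ->
  (forall i, B_ i i \in unitmx) -> \mxblock_(i, j) B_ i j \in unitmx.
Proof.
move=> Blow Bu; apply: unitmx_inj => x.
rewrite -(submxcolK x) mul_mxblock_mxrow -(mxcol0 1) => /eq_mxcolP Bx0.
apply/eq_mxcolP => i; have [l lei] := ubnP i.
elim: l i lei => // l IHl i lei.
have := Bx0 i; rewrite (bigD1 i) //= big1 => [|j ji]; last first.
  have [/Blow->|lji|/val_inj eij] := ltngtP i j; first by rewrite mul0mx.
    by rewrite IHl ?mulmx0 // (leq_trans lji).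
  by rewrite eij eqxx in ji.
by rewrite addr0 => Bxi; rewrite -(mulKmx (Bu i) (submxcol x i)) Bxi mulmx0.
Qed.

Lemma mulmx_mxdiag (K : pzSemiRingType) p (p_ : 'I_p -> nat)
    (B_ C_ : forall i, 'M[K]_(p_ i)) :
  \mxdiag_i B_ i *m \mxdiag_i C_ i = \mxdiag_i (B_ i *m C_ i).
Proof.
rewrite {2 3}/mxdiag mul_mxdiag_mxblock; apply: eq_mxblock => i j.
by case: eqVneq => [->|]; rewrite ?conform_mx_id ?mulmx0.
Qed.

Lemma invmx_mxdiag (K : comUnitRingType) p (p_ : 'I_p -> nat)
    (B_ : forall i, 'M[K]_(p_ i)) :
  (forall i, B_ i \in unitmx) ->
  invmx (\mxdiag_i B_ i) = \mxdiag_i (invmx (B_ i)).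
Proof.
move=> Bu; have BV : \mxdiag_i B_ i *m \mxdiag_i (invmx (B_ i)) = 1%:M.
  by rewrite mulmx_mxdiag; under eq_mxdiag do rewrite mulmxV //; exact: mxdiagZ.
by rewrite -[LHS]mulmx1 -BV mulKmx //; case: (mulmx1_unit BV).
Qed.

(** * Characteristic polynomials and multiplicities *)

Lemma char_poly_conj (K : comUnitRingType) m (P M : 'M[K]_m) :
  P \in unitmx -> char_poly (invmx P *m M *m P) = char_poly M.
Proof.
move=> Pu; rewrite /char_poly.
have -> : char_poly_mx (invmx P *m M *m P) =
    map_mx polyC (invmx P) *m char_poly_mx M *m map_mx polyC P.
  rewrite /char_poly_mx mulmxBr mulmxBl !map_mxM /=; congr (_ - _).
  by rewrite scalar_mxC -mulmxA -map_mxM mulVmx // map_mx1 mulmx1.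
rewrite !det_mulmx mulrC mulrA -det_mulmx -map_mxM /= mulmxV //.
by rewrite map_mx1 det1 mul1r.
Qed.

Lemma char_poly_mxdiag_scalar (K : comNzRingType) p (p_ : 'I_p -> nat)
    (a : 'I_p -> K) :
  char_poly (\mxdiag_i ((a i)%:M : 'M_(p_ i))) =
  \prod_i ('X - (a i)%:P) ^+ p_ i.
Proof.
rewrite char_poly_trig; last first.
  apply/is_trig_mxblockP; split=> [i j|i].
    by case: eqVneq => // -> /[!ltnn].
  by rewrite eqxx conform_mx_id scalar_mx_is_trig.
transitivity (\prod_i \prod_(j < p_ i) ('X - (a i)%:P)); last first.
  by apply: eq_bigr => i _; rewrite prodr_const card_ord.
rewrite sig_big_dep (reindex _ tagnat.sig_bij_on) /=.
by apply: eq_bigr => s _; rewrite mxE eqxx conform_mx_id mxE eqxx.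
Qed.

Lemma mup_prod_XsubC_exp (F : fieldType) p (e : 'I_p -> nat) (a : 'I_p -> F) z :
  mup z (\prod_i ('X - (a i)%:P) ^+ e i) = (\sum_(i | a i == z) e i)%N.
Proof.
rewrite [RHS]big_mkcond.
suff [] : \prod_i ('X - (a i)%:P) ^+ e i \is monic /\
    mup z (\prod_i ('X - (a i)%:P) ^+ e i) =
    (\sum_i (if a i == z then e i else 0))%N by [].
apply: (big_rec2 (fun q s => q \is monic /\ mup z q = s)) => [|i q s _ [qm qz]].
  by rewrite monic1 mupNroot // root1.
have Xm : ('X - (a i)%:P) ^+ e i \is monic by rewrite monic_exp ?monicXsubC.
by rewrite monicMl // mupM ?monic_neq0 // mup_XsubCX qz.
Qed.

Lemma sum_even m (f : nat -> nat) :
  (\sum_(0 <= i < m | ~~ odd i) f i = \sum_(0 <= j < uphalf m) f (2 * j))%N.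
Proof.
elim: m => [|m IHm]; first by rewrite !big_geq.
rewrite big_mkcond big_nat_recr //= -big_mkcond /= IHm uphalf_half.
have [|] := boolP (odd m); first by rewrite addn0.
by move=> em; rewrite add0n big_nat_recr //= mul2n even_halfK.
Qed.

Lemma sum_odd m (f : nat -> nat) :
  (\sum_(0 <= i < m | odd i) f i = \sum_(0 <= j < half m) f (2 * j).+1)%N.
Proof.
elim: m => [|m IHm]; first by rewrite !big_geq.
rewrite big_mkcond big_nat_recr //= -big_mkcond /= IHm uphalf_half.
have [om|] := boolP (odd m); last by rewrite addn0.
by rewrite add1n big_nat_recr //= mul2n odd_halfK // prednK // odd_gt0.
Qed.

(** * Factorization of the saddle-point matrix *)

Section SaddlePoint.
Variables (R : realType) (n : nat -> nat).
Variables (A : forall j, 'M[R]_(n j)) (B : forall j, 'M[R]_(n j, n j.-1)).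

Lemma spd_schur k j :
  spd (A 0) -> (forall j, (1 <= j <= k)%N -> spsd (A j)) ->
  (forall j, (1 <= j <= k)%N -> ker_trivial_meet (A j) (B j)^T) ->
  (j <= k)%N -> spd (schur A B j).
Proof.
move=> A0 Apsd ker0; elim: j => [|j IHj] lejk //=.
apply: spd_schur_step; [|exact: Apsd|exact: ker0].
exact/spd_invmx/IHj/ltnW.
Qed.

Lemma precL_block_diag i : precL_block A B i i = (-1) ^+ i *: schur A B i.
Proof. by rewrite /precL_block eqxx conform_mx_id. Qed.

Lemma precL_block_sub i : precL_block A B i.+1 i = B i.+1.
Proof. by rewrite /precL_block eqxx gtn_eqF // conform_mx_id. Qed.

Lemma precL_block0 i j : i != j -> i != j.+1 -> precL_block A B i j = 0.
Proof. by rewrite /precL_block => /negPf-> /negPf->. Qed.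

(** Since precL is block bidiagonal, row i of a product with it has only the
    terms i and i - 1; the match discards the second one in row 0. *)
Lemma sum_precL_block k i p (G : forall l, 'M[R]_(n l, p)) : (i <= k)%N ->
  \sum_(l < k.+1) precL_block A B i l *m G l =
  (-1) ^+ i *: schur A B i *m G i +
  (if i is i'.+1 return 'M_(n i, p) then B i'.+1 *m G i' else 0).
Proof.
move=> leik; rewrite (bigD1 (Ordinal (leik : i < k.+1)%N)) //= precL_block_diag.
congr (_ + _); case: i leik => [|i] leik.
  rewrite big1 // => l l0; rewrite precL_block0 ?mul0mx //.
  by move: l0; rewrite -val_eqE eq_sym.
rewrite (bigD1 (Ordinal (ltnW leik : i < k.+1)%N)) /=; last first.
  by rewrite -val_eqE /= ltn_eqF.
rewrite precL_block_sub big1 ?addr0 // => l.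
rewrite -!val_eqE /= => /andP[li1 li].
by rewrite precL_block0 ?mul0mx // 1?eq_sym.
Qed.

Variable k : nat.
Hypothesis S_spd : forall j, (j <= k)%N -> spd (schur A B j).

Let S_unit j : (j <= k)%N -> schur A B j \in unitmx.
Proof. by move=> /S_spd/spd_unitmx. Qed.

Let S_sym j : (j <= k)%N -> (schur A B j)^T = schur A B j.
Proof. by move=> /S_spd[/symmetricmxP]. Qed.

(** Only l = i and l = i - 1 contribute. The term l = i is the transpose of
    block (j, i) of precL, as S_i cancels its inverse. The term l = i - 1
    supplies B_i when j = i - 1; when j = i it has sign (-1)^(i-1) and turns S_i
    back into A_i. *)
Lemma saddle_block_LDU i j : (i <= k)%N -> (j <= k)%N ->
  \sum_(l < k.+1) precL_block A B i l *m
    ((-1) ^+ l *: invmx (schur A B l) *m (precL_block A B j l)^T) =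
  saddle_block A B i j.
Proof.
move=> ik jk.
rewrite (sum_precL_block (fun l =>
  (-1) ^+ l *: invmx (schur A B l) *m (precL_block A B j l)^T)) //.
rewrite mulmxA -!scalemxAl -scalemxAr -scalemxAl scalerA -expr2.
rewrite sqrr_sign scale1r mulmxV ?S_unit // mul1mx /saddle_block.
have [eij|nij] := eqVneq i j.
  rewrite -{}eij in jk *.
  rewrite precL_block_diag linearZ /= S_sym // conform_mx_id.
  case: i ik jk => [|i] ik _; first by rewrite addr0.
  rewrite precL_block_sub /= exprS mulN1r !scaleNr -scalemxAl -scalemxAr mulmxA.
  by rewrite scalerDr opprD -addrA addNr addr0.
have [eij|nij1] := eqVneq i j.+1.
  rewrite eij in ik *; rewrite precL_block0 ?trmx0 ?add0r; try lia.
  rewrite precL_block_diag conform_mx_id linearZ /= S_sym; last lia.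
  rewrite -scalemxAl -!scalemxAr scalerA -expr2 sqrr_sign scale1r.
  by rewrite mulVmx ?S_unit ?mulmx1.
have [eij|nij2] := eqVneq j i.+1.
  rewrite eij precL_block_sub conform_mx_id.
  case: i ik {nij nij1 eij} => [|i] ik; first by rewrite addr0.
  by rewrite precL_block0 ?trmx0 ?mulmx0 ?addr0 //; lia.
rewrite (@precL_block0 j i) ?trmx0 ?add0r //; last by rewrite eq_sym.
case: i ik nij nij1 nij2 => [|i] ik nij nij1 nij2 //.
by rewrite precL_block0 ?trmx0 ?mulmx0 //; lia.
Qed.

Let J : 'M[R]_(\sum_(i < k.+1) n i) :=
  \mxdiag_(i < k.+1) ((-1) ^+ i)%:M.

Lemma invmx_precD :
  invmx (precD A B k) = \mxdiag_(i < k.+1) invmx (schur A B i).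
Proof. by apply: invmx_mxdiag => i; rewrite S_unit // -ltnS. Qed.

Lemma saddle_LDU :
  saddle A B k = precL A B k *m invmx (precD A B k) *m J *m precU A B k.
Proof.
rewrite /precU -(mulmxA _ _ J) invmx_precD mulmx_mxdiag.
rewrite mul_mxblock_mxdiag tr_mxblock mul_mxblock.
apply/esym/eq_mxblock => i j; rewrite -saddle_block_LDU -1?ltnS //.
by apply: eq_bigr => l _; rewrite mul_mx_scalar mulmxA.
Qed.

Lemma precL_unitmx : precL A B k \in unitmx.
Proof.
apply: unitmx_mxblock_lower => [i j lij|i].
  by rewrite precL_block0 //; lia.
by rewrite precL_block_diag unitmxZ ?S_unit -1?ltnS // unitrX // unitrN1.
Qed.

Lemma precU_unitmx : precU A B k \in unitmx.
Proof. by rewrite unitmx_tr precL_unitmx. Qed.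

(** P^-1 (saddle) = (L D^-1 U)^-1 (L D^-1 J U) = U^-1 J U. *)
Lemma prec_saddle_similar :
  invmx (prec A B k) *m saddle A B k =
  invmx (precU A B k) *m J *m precU A B k.
Proof.
have Du : precD A B k \in unitmx.
  rewrite -unitmx_inv invmx_precD; apply: unitmx_mxblock_lower => [i j|i].
    by case: eqVneq => // ->; rewrite ltnn.
  by rewrite eqxx conform_mx_id unitmx_inv S_unit // -ltnS.
have Pu : prec A B k \in unitmx.
  by rewrite /prec !unitmx_mul precL_unitmx unitmx_inv Du precU_unitmx.
rewrite saddle_LDU -[RHS](mulKmx Pu) {3}/prec !mulmxA.
by rewrite mulmxK ?precU_unitmx.
Qed.

Lemma char_poly_prec_saddle :
  char_poly (invmx (prec A B k) *m saddle A B k) =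
  \prod_(i < k.+1) ('X - ((-1) ^+ i)%:P) ^+ n i.
Proof.
rewrite prec_saddle_similar char_poly_conj ?precU_unitmx //.
exact: char_poly_mxdiag_scalar.
Qed.

End SaddlePoint.

Theorem theorem1 (R : realType) (k : nat) (hk : (1 <= k)%N)
    (n : nat -> nat) (hn : forall j : nat, (j <= k)%N -> (0 < n j)%N)
    (A : forall j : nat, 'M[R]_(n j)) (B : forall j : nat, 'M[R]_(n j, n j.-1))
    (hA0 : spd (A 0%N))
    (hA : forall j : nat, (1 <= j <= k)%N -> spsd (A j))
    (hker : forall j : nat, (1 <= j <= k)%N -> ker_trivial_meet (A j) (B j)^T) :
  let M := complexify (invmx (prec A B k) *m saddle A B k) in
  (forall z : R[i], eigenvalue M z <-> z = 1 \/ z = -1) /\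
  alg_mult 1 M = (\sum_(0 <= j < (k %/ 2).+1) n (2 * j))%N /\
  alg_mult (-1) M = (\sum_(1 <= j < ((k + 1) %/ 2).+1) n (2 * j - 1))%N.
Proof.
move=> M.
have S_spd j : (j <= k)%N -> spd (schur A B j) by exact: spd_schur.
have charM : char_poly M = \prod_(i < k.+1) ('X - ((-1) ^+ i)%:P) ^+ n i.
  rewrite -map_char_poly char_poly_prec_saddle // rmorph_prod /=.
  apply: eq_bigr => i _.
  by rewrite rmorphXn rmorphB /= map_polyX map_polyC /= rmorph_sign.
have multM z : alg_mult z M = (\sum_(i < k.+1 | (-1) ^+ i == z) n i)%N.
  by rewrite /alg_mult charM mup_prod_XsubC_exp.
have N1 : (-1 : R[i]) == 1 = false.
  by rewrite eq_sym -subr_eq0 opprK (pnatr_eq0 _ 2).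
split; last split.
- move=> z; rewrite eigenvalue_root_char -dvdp_XsubCl.
  rewrite XsubC_dvd ?monic_neq0 ?char_poly_monic // -/(alg_mult z M) multM.
  split=> [|zE].
    have [/existsP[i /eqP <-] _|/existsPn noi] :=
        boolP [exists i : 'I_k.+1, (-1) ^+ i == z].
      by rewrite -signr_odd; case: odd; [right|left].
    by rewrite big_pred0 // => i; apply/negbTE/noi.
  have [i <-] : exists i : 'I_k.+1, (-1) ^+ i = z.
    by case: zE => ->; [exists ord0 | exists (inord 1); rewrite inordK].
  by rewrite (bigD1 i) //= ltn_addr // hn // -ltnS.
- rewrite multM -(big_mkord (fun i => (-1) ^+ i == 1 :> R[i])).
  rewrite divn2 (eq_bigl (fun i => ~~ odd i)) => [|i]; first exact: sum_even.
  by rewrite -signr_odd; case: odd; rewrite ?eqxx.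
- rewrite multM -(big_mkord (fun i => (-1) ^+ i == -1 :> R[i])).
  rewrite (eq_bigl odd) => [|i]; last first.
    by rewrite -signr_odd; case: odd; rewrite ?eqxx // eq_sym.
  rewrite sum_odd big_add1 addn1 divn2; apply: eq_bigr => j _.
  by rewrite mulnS addnC addn2 subn1.
Qed.
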